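(* Let $\beta=\sigma_{i_1}^{\varepsilon_1}\sigma_{i_2}^{\varepsilon_2}\cdots\sigma_{i_\ell}^{\varepsilon_\ell}$ be a braid word on $m$ strands whose closure is a knot, and let $\beta'=\sigma_{i_2}^{\varepsilon_2}\cdots\sigma_{i_\ell}^{\varepsilon_\ell}\sigma_{i_1}^{\varepsilon_1}$ be the braid word obtained from it by cyclic permutation. Then the sets of semi-simple walks of $\beta$ and $\beta'$ coincide, $\mathfrak{S}_{\beta}=\mathfrak{S}_{\beta'}$, where the crossings of $\beta'$ keep the labels they have in $\beta$. That is, the set of semi-simple walks is invariant under cyclic permutation of the braid word.
   Context: Braid words. A braid word on $m$ strands is an expression $\beta=\sigma_{i_1}^{\varepsilon_1}\cdots\sigma_{i_\ell}^{\varepsilon_\ell}$ with $1\le i_k\le m-1$ and $\varepsilon_k=\pm1$. It is read left to right and drawn top to bottom, so crossing $1$ is at the top and crossing $\ell$ at the bottom. Strand positions are numbered $1,\dots,m$ from left to right. In $\sigma_i$ the $(i+1)$-st strand crosses over the $i$-th strand; in $\sigma_i^{-1}$ the $i$-th strand crosses over the $(i+1)$-st. The closure of $\beta$ joins top position $j$ to bottom position $j$ for each $j$ without additional crossings. Paths. A path on $\beta$ goes from the bottom of the braid to the top. On meeting a crossing along the understrand it must stay on the understrand; on meeting it along the overstrand it either stays on the overstrand or ''jumps down'' to the understrand and continues upward. Explicitly, a path is a sequence of positions $(p_\ell,p_{\ell-1},\dots,p_0)$, where $p_\ell$ is the position at the bottom, $p_0$ the position at the top, and the step $p_k\to p_{k-1}$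 through crossing $k$ (with $i=i_k$) is as follows: if $p_k\notin\{i,i+1\}$ then $p_{k-1}=p_k$; if $\varepsilon_k=+1$, then $i\to i+1$ (overstrand), $i\to i$ (jump down), $i+1\to i$ (understrand) are the allowed steps; if $\varepsilon_k=-1$, then $i+1\to i$ (overstrand), $i+1\to i+1$ (jump down), $i\to i+1$ (understrand) are the allowed steps. Walks. A walk $W$ on $\beta$ consists of a nonempty set $J\subseteq\{1,\dots,m\}$, a permutation $\pi$ of $J$, and exactly one path from $j$ (at the bottom) to $\pi(j)$ (at the top) for each $j\in J$. The walk is simple if no two of its paths intersect, i.e. at each level between consecutive crossings (and at top and bottom) its paths occupy distinct positions (one path may cross over another at a crossing). A crossing is active for $W$ if some path of $W$ jumps down there. Simple walks. When the closure of $\beta$ is a knot, a simple walk with $J\subseteq\{2,\dots,m\}$ is identified with its set of active crossings (a subset of the set of crossings; equivalently a squarefree monomial in $a_1,\dots,a_\ell$). $SW_\beta$ denotes the set of simple walks on $\beta$ with $J\subseteq\{2,\dots,m\}$, viewed in this way as a set of subsets of the set of crossings. Reflection and semi-simple walks. The reflection of $\beta$ is $\beta^*=\sigma_{i_1}^{-\varepsilon_1}\cdots\sigma_{i_\ell}^{-\varepsilon_\ell}$; its crossings carry the same labels as those of $\beta$. The set of semi-simple walks on $\beta$ is $\mathfrak{S}_\beta=SW_\beta\cup SW_{\beta^*}$. Convention for cyclic permutation. The $k$-th letter of $\beta$ ($k\ge2$) is the $(k-1)$-st letter of $\beta'$ and the first letter of $\beta$ is the last letter of $\beta'$; corresponding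 crossings are identified and given the same label, so that sets of active crossings of $\beta$ and $\beta'$ can be compared. *)

(* Defs.v *)
From mathcomp Require Import all_boot all_fingroup.

Set Implicit Arguments.
Unset Strict Implicit.
Unset Printing Implicit Defensive.

(* Everything is numbered from 0: strand positions are 'I_m, crossings are
   'I_l, and (i, e) : letter m is sigma_(i+1) if e = true and its inverse if
   e = false; that crossing involves positions i and i+1 of 'I_m. *)
Definition letter (m : nat) : Type := ('I_m.-1 * bool)%type.
Definition braid (m l : nat) : Type := l.-tuple (letter m).

Lemma right_pos_subproof m (i : 'I_m.-1) : i.+1 < m.
Proof. by case: m i => [|m] [i lti]. Qed.

Definition left_pos m (i : 'I_m.-1) : 'I_m := widen_ord (leq_pred m) i.
Definition right_pos m (i : 'I_m.-1) : 'I_m := Ordinal (right_pos_subproof i).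

(* Positions at the bottom of the crossing: going up, the overstrand runs from
   over_foot x to under_foot x and the understrand from under_foot x to
   over_foot x. *)
Definition over_foot m (x : letter m) : 'I_m :=
  if x.2 then left_pos x.1 else right_pos x.1.
Definition under_foot m (x : letter m) : 'I_m :=
  if x.2 then right_pos x.1 else left_pos x.1.

(* Level k : 'I_l.+1 lies just below the first k crossings: level 0 is the top
   of the braid, ord_max the bottom. *)
Definition above l (c : 'I_l) : 'I_l.+1 := widen_ord (leqnSn l) c.
Definition below l (c : 'I_l) : 'I_l.+1 := lift ord0 c.

(* Travelling upwards along the strands of the closed braid from the point at
   level u.1 and position u.2, and from the top back to the bottom along the
   closing arcs. The orbits are the components of the closure. *)
Definition closure_next m l (b : braid m l) (u : 'I_l.+1 * 'I_m) :
    'I_l.+1 * 'I_m :=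
  if unlift ord0 u.1 is Some c then
    let x := tnth b c in (above c, tperm (over_foot x) (under_foot x) u.2)
  else (ord_max, u.2).

Definition closure_is_knot m l (b : braid m l) : bool :=
  fcard (closure_next b) predT == 1.

Definition step m (x : letter m) (p q : 'I_m) : bool :=
  if p == over_foot x then (q == under_foot x) || (q == over_foot x)
  else if p == under_foot x then q == over_foot x
  else q == p.

Definition jump m (x : letter m) (p q : 'I_m) : bool :=
  (p == over_foot x) && (q == over_foot x).

Definition is_path m l (b : braid m l) (p : {ffun 'I_l.+1 -> 'I_m}) : bool :=
  [forall c, step (tnth b c) (p (below c)) (p (above c))].

(* A permutation of J is represented by its extension to 'I_m by the identity.
   The values of walk_path outside J are junk. *)
Definition walk_data (m l : nat) : Type :=
  ({set 'I_m} * {perm 'I_m} * {ffun 'I_m -> {ffun 'I_l.+1 -> 'I_m}})%type.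

Section Walks.
Variables (m l : nat) (b : braid m l).
Implicit Type W : walk_data m l.

Definition walk_set W : {set 'I_m} := W.1.1.
Definition walk_perm W : {perm 'I_m} := W.1.2.
Definition walk_path W : {ffun 'I_m -> {ffun 'I_l.+1 -> 'I_m}} := W.2.

Definition is_walk W : bool :=
  [&& walk_set W != set0, perm_on (walk_set W) (walk_perm W) &
      [forall j in walk_set W,
         [&& is_path b (walk_path W j),
             walk_path W j ord_max == j &
             walk_path W j ord0 == walk_perm W j]]].

Definition is_simple W : bool :=
  [forall i in walk_set W, forall j in walk_set W, (i != j) ==>
     [forall k, walk_path W i k != walk_path W j k]].

Definition active W : {set 'I_l} :=
  [set c | [exists j in walk_set W,
     jump (tnth b c) (walk_path W j (below c)) (walk_path W j (above c))]].

(* The first strand position, numbered 0 here, is not in J. *)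
Definition avoids_first W : bool := [forall j in walk_set W, 0 < val j].

Definition simple_walks : {set {set 'I_l}} :=
  [set active W | W : walk_data m l &
                  [&& is_walk W, is_simple W & avoids_first W]].

Definition reflection : braid m l := [tuple of map (fun x => (x.1, ~~ x.2)) b].

Definition cyclic_permutation : braid m l := [tuple of rot 1 b].

End Walks.

Definition semi_simple_walks m l (b : braid m l) : {set {set 'I_l}} :=
  simple_walks b :|: simple_walks (reflection b).

(* Crossing c of the cyclic permutation of b is crossing ordS c = c+1 mod l
   of b. *)
Definition original_labels l (S : {set {set 'I_l}}) : {set {set 'I_l}} :=
  [set @ordS l @: A | A : {set 'I_l} in S].

(* Main.v *)
Require Import Defs.
From mathcomp Require Import all_boot all_fingroup.

Set Implicit Arguments.
Unset Strict Implicit.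
Unset Printing Implicit Defensive.

(** A simple walk with active set A occupies a union of components of the
    closed braid smoothed at A, such that at each crossing of A the overfoot
    is occupied and the underfoot is not. Such an occupation is a datum on the
    closed braid alone. Complementation turns occupations for b into
    occupations for the reflection of b, and exactly one of the two avoids the
    first strand at the bottom. Hence the semi-simple walks are the nonempty A
    that admit an occupation; the empty set is excluded because, the closure
    being a knot, it only admits the empty and the full occupation. *)

(** * Occupations *)

Definition crossing_perm m (x : letter m) : {perm 'I_m} :=
  tperm (over_foot x) (under_foot x).

Definition occupation_step m (x : letter m) (is_active : bool)
    (S T : {set 'I_m}) : bool :=
  if is_active then [&& over_foot x \in S, under_foot x \notin S & T == S]
  else T == crossing_perm x @: S.

(* [s c] is the set of positions occupied just below crossing [c]; the closing
   arcs identify the level just above [c] with the one just below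
   [ord_pred c]. *)
Definition is_occupation m l (b : braid m l) (A : {set 'I_l})
    (s : 'I_l -> {set 'I_m}) : Prop :=
  forall c, occupation_step (tnth b c) (c \in A) (s c) (s (ord_pred c)).

Lemma over_under_neq m (x : letter m) : over_foot x != under_foot x.
Proof.
case: x => i [] /=; rewrite -val_eqE /=.
  by rewrite (ltn_eqF (ltnSn i)).
by rewrite (gtn_eqF (ltnSn i)).
Qed.

Lemma tnth_reflection m l (b : braid m l) c :
  tnth (reflection b) c = ((tnth b c).1, ~~ (tnth b c).2).
Proof. by rewrite tnth_map. Qed.

(** Reflection exchanges the overfoot and the underfoot of each crossing, as complementation
    exchanges the two membership conditions at an active crossing. The transposition of the two feet
    is unchanged and commutes with complements. *)
Lemma is_occupation_reflection m l (b : braid m l) A s :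
  is_occupation b A s -> is_occupation (reflection b) A (fun c => ~: s c).
Proof.
move=> occ c; move: (occ c); rewrite /occupation_step tnth_reflection.
rewrite /crossing_perm.
have -> x : over_foot ((x.1, ~~ x.2) : letter m) = under_foot x.
  by case: x => i [].
have -> x : under_foot ((x.1, ~~ x.2) : letter m) = over_foot x.
  by case: x => i [].
case: ifP => _.
  by case/and3P=> o u /eqP ->; rewrite !inE o u eqxx.
move=> /eqP ->; apply/eqP/setP => p; rewrite tpermC.
set t := tperm _ _; have [q ->] : exists q, p = t q.
  by exists (t p); rewrite tpermK.
by rewrite in_setC !(mem_imset _ _ (@perm_inj _ t)) in_setC.
Qed.

Lemma reflectionK m l (b : braid m l) : reflection (reflection b) = b.
Proof.
apply: eq_from_tnth => c.
by rewrite !tnth_reflection; case: (tnth b c) => i e /=; rewrite negbK.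
Qed.

Lemma tnth_cyclic_permutation m l (b : braid m l) c :
  tnth (cyclic_permutation b) c = tnth b (ordS c).
Proof.
case: l b c => [b [] //|n b c].
rewrite (tnth_nth (tnth b ord0)) [RHS](tnth_nth (tnth b ord0)) /=.
case: b => -[|x s] //= sz_s; rewrite rot1_cons nth_rcons.
have /eqP[->] := sz_s.
have := ltn_ord c; rewrite ltnS leq_eqVlt => /orP[/eqP ->|lt_cn].
  by rewrite ltnn eqxx modnn.
by rewrite lt_cn modn_small.
Qed.

Lemma is_occupation_cyclic m l (b : braid m l) (A : {set 'I_l}) s :
  is_occupation b (@ordS l @: A) s <->
  is_occupation (cyclic_permutation b) A (s \o @ordS l).
Proof.
split=> occ c.
  move: (occ (ordS c)); rewrite (mem_imset _ _ (@ordS_inj l)) ordSK.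
  by rewrite tnth_cyclic_permutation /= ord_predK.
move: (occ (ord_pred c)); rewrite tnth_cyclic_permutation /= !ord_predK.
by rewrite -(mem_imset _ _ (@ordS_inj l)) ord_predK.
Qed.

Lemma occupation_cardS m l (b : braid m l) A s c :
  is_occupation b A s -> #|s (ord_pred c)| = #|s c|.
Proof.
move=> /(_ c); rewrite /occupation_step; case: ifP => _.
  by case/and3P=> _ _ /eqP ->.
by move/eqP ->; rewrite card_imset //; apply: perm_inj.
Qed.

(** Each crossing either keeps the occupied set or moves it by a permutation. This carries
    nonemptiness from an active crossing to the bottom of the braid. *)
Lemma occupation_card m l (b : braid m l) A s c d :
  is_occupation b A s -> #|s c| = #|s d|.
Proof.
case: l b A s c d => [b A s [] //|n b A s c d] occ.
suff card0 (e : 'I_n.+1) : #|s e| = #|s ord0| by rewrite !card0.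
case: e => k; elim: k => [|k IHk] lt_kn.
  by congr #|s _|; apply: val_inj.
rewrite -(occupation_cardS _ occ) -(IHk (ltnW lt_kn)); congr #|s _|.
apply: val_inj => /=; rewrite modnDr modn_small //.
exact: ltnW.
Qed.

(** * The knot condition *)

(** The form in which the knot hypothesis is used below. It passes easily to the reflection and to
    the cyclic permutation, so these need not be shown to close up to knots. *)
Definition only_trivial_occupations m l (b : braid m l) : Prop :=
  forall s, is_occupation b set0 s -> forall c, s c = set0 \/ s c = setT.

Lemma below_ord_pred l (c : 'I_l) :
  0 < val c -> below (ord_pred c) = above c.
Proof.
move=> c_gt0; apply: val_inj; case: c c_gt0 => -[|k] //= lt_kl _.
by rewrite /bump /= addSn /= modnDr modn_small // ltnW.
Qed.

Lemma below_ord_pred0 n : below (ord_pred (@ord0 n)) = ord_max.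
Proof. by apply: val_inj; rewrite /= /bump /= modn_small. Qed.

Lemma closure_next_inj m l (b : braid m l) : injective (closure_next b).
Proof.
move=> [k p] [k' p']; rewrite /closure_next /=.
case: unliftP => [c|] ->; case: unliftP => [c'|] -> //= [].
- move/eqP=> eq_c; have -> : c = c' by apply/eqP.
  by move/perm_inj->.
- by move=> c_max; have := ltn_ord c; rewrite c_max ltnn.
- by move=> c_max; have := ltn_ord c'; rewrite -c_max ltnn.
- by move->.
Qed.

(** Without active crossings, being occupied is invariant under [closure_next], hence constant on
    its single orbit. *)
Lemma knot_only_trivial_occupations m l (b : braid m l) :
  closure_is_knot b -> only_trivial_occupations b.
Proof.
case: l b => [b _ s _ [] //|n b] /eqP one_orbit s occ c.
(* The occupied set at each level; the top level is joined to the bottom one by the closing arcs,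
   whence [s ord_max]. *)
pose lev (k : 'I_n.+2) := if unlift ord0 k is Some d then s d else s ord_max.
have lev_below d : lev (below d) = s d by rewrite /lev /below liftK.
have lev_0 : lev ord0 = s ord_max by rewrite /lev unlift_none.
have lev_above d : lev (above d) = s (ord_pred d).
  have [d0|d_gt0] := posnP (val d); last by rewrite -below_ord_pred.
  have -> : d = ord0 by apply: val_inj.
  have -> : above (@ord0 n) = ord0 by apply: val_inj.
  rewrite lev_0; congr s.
  by apply: val_inj; rewrite /= modn_small.
pose P (u : 'I_n.+2 * 'I_m) := u.2 \in lev u.1.
have P_next u : P (closure_next b u) = P u.
  case: u => k p; rewrite /P /closure_next /=.
  case: unliftP => [d|] -> /=.
    have := occ d; rewrite /occupation_step inE => /eqP sd.
    rewrite lev_above sd (mem_imset _ _ (@perm_inj _ _)).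
    by rewrite -lev_below.
  suff -> : lev ord_max = lev ord0 by [].
  by rewrite lev_0 -lev_below; congr lev; apply: val_inj.
have P_connect u v : fconnect (closure_next b) u v -> P v = P u.
  case/connectP=> q; elim: q u => [u _ -> //|w q IHq u /= /andP[/eqP <- qP] ?].
  by rewrite (IHq _ qP).
have P_const u v : P u = P v.
  have /card_le1_eqP rootE : #|predI (froots (closure_next b)) predT| <= 1.
    by move: one_orbit; rewrite /n_comp_mem => ->.
  rewrite -(P_connect _ _ (connect_root _ u)).
  rewrite -(P_connect _ _ (connect_root _ v)).
  by congr P; apply: rootE; rewrite inE /= andbT roots_root //;
     apply: fconnect_sym (@closure_next_inj _ _ b).
have [->|[p0 sp0]] := set_0Vmem (s c); [by left|right].
apply/setP=> p; rewrite inE; move: (P_const (below c, p) (below c, p0)).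
by rewrite /P /= !lev_below sp0.
Qed.

Lemma only_trivial_occupations_reflection m l (b : braid m l) :
  only_trivial_occupations b -> only_trivial_occupations (reflection b).
Proof.
move=> triv s /is_occupation_reflection; rewrite reflectionK => occ c.
have [sc|sc] := triv _ occ c; [right|left]; apply: setC_inj.
  by rewrite sc setCT.
by rewrite sc setC0.
Qed.

Lemma only_trivial_occupations_cyclic m l (b : braid m l) :
  only_trivial_occupations b ->
  only_trivial_occupations (cyclic_permutation b).
Proof.
move=> triv s occ c; rewrite -[c]ordSK.
apply: (triv (s \o @ord_pred l)) => d.
have := occ (ord_pred d).
by rewrite tnth_cyclic_permutation ord_predK !inE.
Qed.

(** * Walks and occupations *)

Lemma stepE m (x : letter m) p q : step x p q ->
  q = if jump x p q then p else crossing_perm x p.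
Proof.
rewrite /step /jump /crossing_perm; case: eqVneq => [->|po] /=.
  case/orP=> /eqP ->; last by rewrite eqxx.
  by rewrite eq_sym (negPf (over_under_neq x)) tpermL.
case: eqVneq => [->|pu] /eqP -> //; first by rewrite tpermR.
by rewrite tpermD // eq_sym.
Qed.

Section WalkOccupation.
Variables (m n : nat) (b : braid m n.+1).

(** The occupation records where the paths are at each level. It closes up because the walk permutes
    [J], so that top and bottom carry the same set. *)
Lemma walk_occupation A : A \in simple_walks b ->
  exists s, [/\ is_occupation b A s, s ord_max != set0 &
                {in s ord_max, forall j, 0 < val j}].
Proof.
case/imsetP=> W; rewrite inE => /and3P[/and3P[J0 piJ /forall_inP pathsP]].
move=> /forall_inP simpleW /forall_inP avoidW AW.
set J := walk_set W in J0 piJ pathsP simpleW avoidW.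
pose pa := walk_path W.
pose S k := [set pa j k | j in J].
have pa_inj k : {in J &, injective (pa^~ k)}.
  move=> i j iJ jJ /= /eqP eq_ij; apply/eqP; apply: contraLR eq_ij => ne_ij.
  by have /forall_inP/(_ j jJ)/implyP/(_ ne_ij)/forallP := simpleW i iJ.
have S_max : S ord_max = J.
  rewrite -[RHS]imset_id; apply: eq_in_imset => j /pathsP.
  by case/and3P=> _ /eqP.
have S_0 : S ord0 = J.
  rewrite -(im_perm_on piJ); apply: eq_in_imset => j /pathsP.
  by case/and3P=> _ _ /eqP.
have S_max' : S (below ord_max) = J.
  by rewrite -S_max; congr S; apply: val_inj.
have S_above c : S (below (ord_pred c)) = S (above c).
  have [c0|c_gt0] := posnP (val c); last by rewrite below_ord_pred.
  have -> : c = ord0 by apply: val_inj.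
  by rewrite below_ord_pred0 S_max -S_0; congr S; apply: val_inj.
exists (S \o @below n.+1); split; rewrite /= ?S_max' //.
move=> c; rewrite /= S_above; set x := tnth b c.
have stepJ j : j \in J -> step x (pa j (below c)) (pa j (above c)).
  by case/pathsP/and3P=> /forallP/(_ c).
rewrite /occupation_step AW inE; case: exists_inP => [[j jJ jumpj]|nojump].
  have /andP[/eqP bj /eqP aj] := jumpj.
  (* A path entering along the understrand is forced to the overfoot, where it would meet the
     jumping path [j]. *)
  have under_free i : i \in J -> pa i (below c) != under_foot x.
    move=> iJ; apply/eqP => bi; have := stepJ i iJ.
    rewrite /step bi eq_sym (negPf (over_under_neq x)) eqxx => /eqP ai.
    have ij : i = j by apply: (pa_inj (above c)); rewrite //= ai aj.
    have := over_under_neq x; rewrite -bi -bj ij -/pa; case/eqP.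
    by rewrite /pa.
  apply/and3P; split.
  - by apply/imsetP; exists j.
  - by apply/imsetP => -[i iJ ui]; have := under_free i iJ; rewrite ui eqxx.
  (* Only [j] enters at the overfoot, and it jumps down; all other paths miss both feet and go
     straight. *)
  - apply/eqP/eq_in_imset => i iJ; have := stepJ i iJ; rewrite /step.
    rewrite (negPf (under_free i iJ)).
    case: (eqVneq (pa i (below c)) (over_foot x)) => [bi _|_ /eqP //].
    have -> : i = j by apply: (pa_inj (below c)); rewrite //= bi -bj.
    by rewrite /pa bj aj.
apply/eqP; rewrite /S -imset_comp; apply: eq_in_imset => j jJ /=.
rewrite (stepE (stepJ j jJ)); case: ifP => // jumpj.
by case: nojump; exists j.
Qed.

(** The paths follow the braid smoothed at [A]. Every level is reached from the bottom by a
    permutation, so distinct paths never meet. *)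
Lemma occupation_walk A s : is_occupation b A s -> s ord_max != set0 ->
  {in s ord_max, forall j, 0 < val j} -> A \in simple_walks b.
Proof.
move=> occ J0 J_avoid; set J := s ord_max in J0 J_avoid.
pose F c := if c \in A then 1%g else crossing_perm (tnth b c).
(* [h d] carries bottom positions up through the lowest [d] crossings. After [d'] of them the next
   one is crossing [n - d'], which is in range, so [inord] never takes its default value. *)
pose h := fix h d : {perm 'I_m} :=
  if d is d'.+1 then (h d' * F (inord (n - d')))%g else 1%g.
pose H (k : 'I_n.+2) := h (n.+1 - k).
have H_max : H ord_max = 1%g by rewrite /H subnn.
have H_above c : H (above c) = (H (below c) * F c)%g.
  have le_cn : c <= n by rewrite -ltnS.
  rewrite /H /= /bump /= add1n subSS subSn //=.
  by rewrite subKn // inord_val.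
have occF c : s (ord_pred c) = F c @: s c.
  have := occ c; rewrite /occupation_step /F; case: ifP => _.
    case/and3P=> _ _ /eqP ->; rewrite -[LHS]imset_id.
    by apply: eq_imset => p; rewrite perm1.
  by move/eqP.
have H_below c : H (below c) @: J = s c.
  move def_d: (n - c) => d; elim: d c def_d => [|d IHd] c def_d.
    have -> : c = ord_max.
      apply: val_inj; apply/eqP.
      by rewrite eqn_leq -ltnS ltn_ord /= -subn_eq0 def_d.
    have -> : below (@ord_max n) = ord_max by apply: val_inj.
    by rewrite H_max -[RHS]imset_id; apply: eq_imset => p; rewrite perm1.
  have lt_cn : c < n by rewrite -subn_gt0 def_d.
  have val_Sc : val (ordS c) = c.+1 by rewrite /= modn_small.
  have <- : above (ordS c) = below c.
    by rewrite -below_ord_pred ?ordSK // val_Sc.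
  rewrite H_above -[c in RHS]ordSK occF -(IHd (ordS c)).
    by rewrite -imset_comp; apply: eq_imset => p; rewrite /= permM.
  by rewrite val_Sc subnS def_d.
have H_0 : H ord0 @: J = J.
  have -> : @ord0 n.+1 = above ord0 by apply: val_inj.
  transitivity (s (ord_pred ord0)).
    rewrite H_above occF -(H_below ord0) -imset_comp.
    by apply: eq_imset => p; rewrite /= permM.
  by congr s; apply: val_inj; rewrite /= modn_small.
(* Going straight is allowed at an active crossing because no path stands at the underfoot; at the
   other crossings the transposition is never a jump. *)
have H_step j c : j \in J ->
    step (tnth b c) (H (below c) j) (H (above c) j) /\
    (jump (tnth b c) (H (below c) j) (H (above c) j) -> c \in A).
  move=> jJ; rewrite H_above permM; have := occ c.
  have : H (below c) j \in s c by rewrite -H_below imset_f.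
  rewrite /occupation_step /F /step /jump; set p := H _ j; set x := tnth b c.
  case: ifP => [_ ps|_ _ _]; last first.
    rewrite /crossing_perm; case: tpermP => [->|->|/eqP po /eqP pu].
    - by rewrite !eqxx /= eq_sym (negPf (over_under_neq x)).
    - by rewrite eq_sym (negPf (over_under_neq x)) !eqxx.
    - by rewrite (negPf po) (negPf pu) eqxx.
  case/and3P=> _ us _; rewrite perm1; split=> //.
  case: ifP => [->|_]; first by rewrite orbT.
  by case: ifP => [/eqP pu|_ //]; rewrite pu (negPf us) in ps.
(* [H ord0] stabilises [J] by [H_0], but it may move points outside [J], hence the restriction. *)
pose W : walk_data m n.+1 :=
  (J, restr_perm J (H ord0), [ffun j => [ffun k => H k j]]).
have WE j k : walk_path W j k = H k j by rewrite /walk_path !ffunE.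
apply/imsetP; exists W.
  rewrite inE; apply/and3P; split.
  - apply/and3P; split; rewrite /walk_set /walk_perm /= ?restr_perm_on //.
    apply/forall_inP=> j jJ; rewrite !WE H_max perm1 eqxx /=.
    apply/andP; split.
      by apply/forallP=> c; rewrite !WE; case: (H_step j c jJ).
    rewrite restr_permE //; apply/astabsP => p /=.
    by rewrite apermE -{1}H_0 (mem_imset _ _ (@perm_inj _ _)).
  - apply/forall_inP=> i _; apply/forall_inP=> j _; apply/implyP=> ne_ij.
    by apply/forallP=> k; rewrite !WE (inj_eq (@perm_inj _ _)).
  - by apply/forall_inP.
apply/setP=> c; rewrite inE; apply/idP/exists_inP => [cA|[j jJ]]; last first.
  by rewrite !WE; apply: (H_step j c jJ).2.
(* The overfoot of an active crossing is occupied, so some path arrives there, and it jumps. *)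
have := occ c; rewrite /occupation_step cA => /and3P[].
rewrite -H_below => /imsetP[j jJ oj] _ _; exists j => //.
by rewrite !WE H_above permM /F cA perm1 /jump -oj eqxx.
Qed.

End WalkOccupation.

(** * Semi-simple walks as nonempty sets admitting an occupation *)

Lemma occupation_of_simple_walk m n (b : braid m n.+1) A :
  only_trivial_occupations b -> A \in simple_walks b ->
  A != set0 /\ exists s, is_occupation b A s.
Proof.
move=> triv /walk_occupation[s [occ J0 avoid]]; split; last by exists s.
(* An empty [A] would make the bottom set empty or full, and a full one contains the first
   strand. *)
apply/eqP=> A0; rewrite A0 in occ; have [J_0|J_T] := triv s occ ord_max.
  by rewrite J_0 eqxx in J0.
have /set0Pn[j _] := J0.
have m_gt0 : 0 < m by apply: leq_ltn_trans (ltn_ord j).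
by have := avoid (Ordinal m_gt0); rewrite J_T inE => /(_ isT).
Qed.

Lemma semi_simple_walksP m n (b : braid m n.+1) A :
  only_trivial_occupations b ->
  (A \in semi_simple_walks b <->
   A != set0 /\ exists s, is_occupation b A s).
Proof.
move=> triv; split=> [|[/set0Pn[c cA] [s occ]]]; rewrite inE.
  case/orP; first exact: occupation_of_simple_walk.
  have triv' := only_trivial_occupations_reflection triv.
  case/(occupation_of_simple_walk triv') => A0 [s occ]; split=> //.
  exists (fun c => ~: s c).
  by rewrite -[b]reflectionK; apply: is_occupation_reflection.
(* At the active crossing [c] the overfoot lies in [s c] and the underfoot in its complement, so
   both occupations are nonempty there and hence at the bottom. *)
have := occ c; rewrite /occupation_step cA => /and3P[o_s u_s _].
have [/exists_inP[j0 j0J /eqP j0_0]|/exists_inPn avoid] :=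
    boolP [exists j in s ord_max, val j == 0].
  apply/orP; right.
  apply: (occupation_walk (is_occupation_reflection occ)).
    have := occupation_card c ord_max (is_occupation_reflection occ).
    rewrite -card_gt0 => <-; apply/card_gt0P.
    by exists (under_foot (tnth b c)); rewrite inE.
  move=> j; rewrite inE lt0n; apply: contra => /eqP j_0.
  by have -> : j = j0 by apply: val_inj; rewrite j_0 j0_0.
apply/orP; left; apply: (occupation_walk occ).
  rewrite -card_gt0 -(occupation_card c _ occ); apply/card_gt0P.
  by exists (over_foot (tnth b c)).
by move=> j /avoid; rewrite lt0n.
Qed.

Theorem theorem5p3 (m l : nat) (b : braid m l) (l_gt0 : 0 < l)
    (b_knot : closure_is_knot b) :
  semi_simple_walks b =
  original_labels (semi_simple_walks (cyclic_permutation b)).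
Proof.
case: l b l_gt0 b_knot => // n b _ /knot_only_trivial_occupations triv.
have triv' := only_trivial_occupations_cyclic triv.
apply/setP=> A; apply/idP/imsetP => [|[B]].
  case/(semi_simple_walksP _ triv) => A0 [s occ].
  have defA : A = @ordS n.+1 @: (@ord_pred n.+1 @: A).
    rewrite -imset_comp -[LHS]imset_id; apply: eq_imset => c /=.
    by rewrite ord_predK.
  exists (@ord_pred n.+1 @: A) => //; apply/(semi_simple_walksP _ triv').
  split; first by rewrite imset_eq0.
  by exists (s \o @ordS n.+1); apply/is_occupation_cyclic; rewrite -defA.
case/(semi_simple_walksP _ triv') => B0 [s occ] ->.
apply/(semi_simple_walksP _ triv); split; first by rewrite imset_eq0.
(* Shifting back by [ordS] returns [s] only pointwise, so the condition is checked crossing by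
   crossing. *)
exists (s \o @ord_pred n.+1); apply/is_occupation_cyclic => c /=.
by rewrite !ordSK.
Qed.
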